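(* Let $a<b$ be real numbers, let $g:\mathbb{R}\to\mathbb{R}$ be non-decreasing and left continuous, and let $D_g\cap[a,b)=\{d_k\}_{k\in\Lambda}$ with $\Lambda\subset\mathbb{N}$. A set $S\subset\operatorname{DC}_g([a,b],\mathbb{F})$ is totally bounded (in the norm $\|\cdot\|_{\operatorname{DC}}$) if and only if 1. $S(t)=\{f(t):f\in S\}$ is bounded for all $t\in[a,b]$; 2. $S$ is $g$-equicontinuous; 3. $S$ is $g$-stable; 4. for every $\varepsilon>0$ there exists $n$ such that for any $f\in S$, $$\sum_{k>n}|\Delta f(d_k)|<\varepsilon.$$
   Context: $\mathbb{F}$ is $\mathbb{R}$ or $\mathbb{C}$. For a function $u$, $u(t^+)$ is the right-hand limit at $t$ and $\Delta u(t)=u(t^+)-u(t)$; $D_g=\{t\in\mathbb{R}:\Delta g(t)>0\}$; the enumeration $\{d_k\}_{k\in\Lambda}$ is without repetition and sums over $k>n$ run over $k\in\Lambda$, $k>n$. A function $f:[a,b]\to\mathbb{F}$ is $g$-continuous if for every $t\in[a,b]$ and $\varepsilon>0$ there is $\delta>0$ with $|f(t)-f(s)|<\varepsilon$ for all $s\in[a,b]$ with $|g(t)-g(s)|<\delta$; $\operatorname{BC}_g([a,b],\mathbb{F})$ is the space of bounded $g$-continuous functions with the supremum norm. $\operatorname{DC}_g([a,b],\mathbb{F})$ is the set of $f\in\operatorname{BC}_g([a,b],\mathbb{F})$ such that $f(t^+)$ exists for every $t\in D_g\cap[a,b)$ and $\sum_{t\in D_g\cap[a,b)}|\Delta f(t)|<\infty$,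 with norm $\|f\|_{\operatorname{DC}}=\|f\|_\infty+\|f_g'\chi_{D_g}\|_1$, where $f_g'(t)=\Delta f(t)/\Delta g(t)$ for $t\in D_g\cap[a,b)$ and $\|\cdot\|_1$ is the $L^1$ norm on $[a,b)$ with respect to the Lebesgue–Stieltjes measure $\mu_g$ ($\mu_g([x,y))=g(y)-g(x)$), so that $\|f_g'\chi_{D_g}\|_1=\sum_{t\in D_g\cap[a,b)}|\Delta f(t)|$. $S$ is $g$-equicontinuous if for every $\varepsilon>0$ and $t\in[a,b]$ there is $\delta>0$ such that $|f(t)-f(s)|<\varepsilon$ for every $f\in S$ and every $s\in[a,b]$ with $|g(t)-g(s)|<\delta$. $S$ is $g$-stable if for every $t\in[a,b)\cap D_g$ and every $\varepsilon>0$ there exist $\delta>0$ and a finite covering $\{X_k\}_{k=1}^m$ of $[t,t+\delta)\cap[a,b]$ such that $|f(x)-f(y)|<\varepsilon$ for every $f\in S$, every $k=1,\dots,m$ and all $x,y\in X_k$. *)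

(* Defs.v *)
From HB Require Import structures.
From mathcomp Require Import all_boot all_order all_algebra.
From mathcomp Require Import all_classical all_reals all_analysis.
From mathcomp Require Import measurable_realfun.
From mathcomp Require Import complex.

Set Implicit Arguments.
Unset Strict Implicit.
Unset Printing Implicit Defensive.

Import Order.TTheory GRing.Theory Num.Theory.
Import numFieldNormedType.Exports.

Local Open Scope classical_set_scope.
Local Open Scope ring_scope.

(* [Rcomplex R] is R[i] seen as a vector space over R: its norm is the modulus
   with values in R, whereas the norm of R[i] takes its values in R[i]. *)
Section Rcomplex_normedModType.
Variable R : realType.

Lemma Rcomplex_normrZ (l : R) (x : Rcomplex R) : `|l *: x| = `|l| * `|x|.
Proof.
case: x => x y.
suff : Num.sqrt ((l * x) ^+ 2 + (l * y) ^+ 2) =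
  `|l| * Num.sqrt (x ^+ 2 + y ^+ 2) by [].
by rewrite !exprMn -mulrDr sqrtrM ?sqr_ge0// sqrtr_sqr.
Qed.

HB.instance Definition _ :=
  PseudoMetric.copy (Rcomplex R) (pseudoMetric_normed (Rcomplex R)).
HB.instance Definition _ := isPointed.Build (Rcomplex R) 0.
HB.instance Definition _ :=
  NormedZmod_PseudoMetric_eq.Build R (Rcomplex R) erefl.
HB.instance Definition _ :=
  PseudoMetricNormedZmod_Lmodule_isNormedModule.Build R (Rcomplex R)
    Rcomplex_normrZ.

End Rcomplex_normedModType.

Variant scalar_field := RealScalars | ComplexScalars.

Definition scalars (R : realType) (F : scalar_field) : normedModType R :=
  match F with
  | RealScalars => R^o
  | ComplexScalars => Rcomplex R
  end.

Record derivator (R : realType) := Derivator {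
  derivator_fun :> R -> R ;
  derivator_nondecreasing : {homo derivator_fun : x y / x <= y} ;
  derivator_left_continuous :
    forall x, derivator_fun y @[y --> x^'-] --> derivator_fun x }.

(* The library builds Lebesgue-Stieltjes measures from right-continuous
   functions, through mu ]x, y] = h y - h x. For a left-continuous g, take
   h x = - g (- x) and transport the measure by x |-> - x. *)
Section derivator_measure.
Variables (R : realType) (g : derivator R).

Definition refl_derivator (x : R) : R := - g (- x).

Lemma refl_derivator_nondecreasing : {homo refl_derivator : x y / x <= y}.
Proof.
by move=> x y xy; rewrite lerN2; apply: derivator_nondecreasing; rewrite lerN2.
Qed.

Lemma refl_derivator_right_continuous : right_continuous refl_derivator.
Proof.
move=> x; apply: cvgN; rewrite -[X in X^'+]opprK.
exact/cvg_at_leftNP/derivator_left_continuous.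
Qed.

HB.instance Definition _ := isCumulative.Build R _ R refl_derivator
  refl_derivator_nondecreasing refl_derivator_right_continuous.

Definition derivator_measure : set (measurableTypeR R) -> \bar R :=
  pushforward (lebesgue_stieltjes_measure refl_derivator)
    (-%R : measurableTypeR R -> measurableTypeR R).

HB.instance Definition _ := Measure.copy derivator_measure
  (@measure_function_pushforward__canonical__measure_function_Measure
     _ _ (measurableTypeR R) (measurableTypeR R) R
     (lebesgue_stieltjes_measure refl_derivator) -%R
     (@oppr_measurable R setT)).

Lemma derivator_measure_itv (x y : R) : x <= y ->
  derivator_measure `[x, y[%classic = (g y - g x)%:E.
Proof.
move=> xy; rewrite /derivator_measure /pushforward.
have -> : -%R @^-1` `[x, y[%classic = `](- y), (- x)]%classic :> set R.
  apply/seteqP; split=> z /=; rewrite !in_itv/= => /andP[h1 h2].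
    by rewrite ltrNl h2 lerNr h1.
  by rewrite lerNr h2 ltrNl h1.
rewrite /lebesgue_stieltjes_measure /measure_extension/=.
rewrite measurable_mu_extE/=; last exact: is_ocitv.
rewrite wlength_itv_bnd ?lerN2//.
by rewrite /refl_derivator !opprK addrC.
Qed.

End derivator_measure.

Section jumps.
Variables (R : realType) (V : normedModType R).
Implicit Type u : R -> V.

Definition rlim u (t : R) : V := lim (u x @[x --> t^'+]).

Definition jump u (t : R) : V := rlim u t - u t.

End jumps.

(* Functions on [a, b] are represented by total functions on R: every notion
   below only depends on the values on [a, b] (right-hand limits are only taken
   at points t < b). *)
Section function_spaces.
Variables (R : realType) (V : normedModType R) (g : derivator R) (a b : R).
Implicit Types (f : R -> V) (S : set (R -> V)).

Definition gjump (t : R) : R := @jump R R^o g t.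

Definition jump_set : set R := [set t | 0 < gjump t].

Definition g_continuous f := forall t, t \in `[a, b] -> forall e : R, 0 < e ->
  exists2 delta : R, 0 < delta & forall s, s \in `[a, b] ->
    `|g t - g s| < delta -> `|f t - f s| < e.

Definition BC : set (R -> V) :=
  [set f | [bounded f t | t in `[a, b]] /\ g_continuous f].

Definition DC : set (R -> V) :=
  [set f | [/\ BC f,
    forall t, (jump_set `&` `[a, b[) t -> cvg (f x @[x --> t^'+]) &
    (\esum_(t in jump_set `&` `[a, b[) `|jump f t|%:E < +oo)%E]].

Definition sup_norm f : \bar R := ereal_sup [set `|f t|%:E | t in `[a, b]].

Definition g_derivative f (t : R) : V := (gjump t)^-1 *: jump f t.

(* The norm takes its values in \bar R; it is finite on DC. *)
Definition DC_norm f : \bar R :=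
  (sup_norm f + \int[derivator_measure g]_(t in `[a, b[)
    `|(g_derivative f \_ jump_set) t|%:E)%E.

Definition DC_totally_bounded S := forall e : R, 0 < e ->
  exists2 C : set (R -> V), finite_set C /\ C `<=` DC &
    forall f, S f -> exists2 c, C c & (DC_norm (f \- c)%R < e%:E)%E.

Definition g_equicontinuous S := forall e : R, 0 < e ->
  forall t, t \in `[a, b] -> exists2 delta : R, 0 < delta &
    forall f, S f -> forall s, s \in `[a, b] ->
      `|g t - g s| < delta -> `|f t - f s| < e.

Definition g_stable S := forall t, t \in `[a, b[ -> jump_set t ->
  forall e : R, 0 < e -> exists2 delta : R, 0 < delta &
    exists (m : nat) (X : 'I_m -> set R),
      [/\ forall k, X k `<=` `[a, b],
        `[t, t + delta[ `&` `[a, b] `<=` \bigcup_k X k &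
        forall f, S f -> forall k x y, X k x -> X k y -> `|f x - f y| < e].

End function_spaces.

(* Main.v *)
(* Since mu_g {t} = g(t^+) - g t, the L^1 part of the DC norm of h is the sum of
   the |jump h (d k)|, so conditions 1-4 pass from the finitely many centers to
   the functions that are uniformly close to them.
   Conversely, equicontinuity and left continuity of g on the left of t, and
   either right continuity of g or stability on its right, give each t in [a, b]
   a neighborhood on which finitely many values determine every f in S up to e;
   by compactness this holds on [a, b].  Rounding these values, which are
   bounded by condition 1, splits S into finitely many uniformly small classes.
   Within a class the jumps at the first d k are small because
   |jump h t| <= 2 sup |h|, and the remaining ones by condition 4. *)
Require Import Defs.
From mathcomp Require Import all_boot all_order all_algebra.
From mathcomp Require Import all_classical all_reals all_analysis.
From mathcomp Require Import complex ring lra.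

Set Implicit Arguments.
Unset Strict Implicit.
Unset Printing Implicit Defensive.

Import Order.TTheory GRing.Theory Num.Theory.
Import numFieldNormedType.Exports.

Local Open Scope classical_set_scope.
Local Open Scope ring_scope.

(** * Right-hand limits of $g$ and atoms of $\mu_g$ *)

Section atoms.
Variables (R : realType) (g : derivator R).

(** Monotone convergence from the right: on $]t,+\infty[$ the function $g$ is non-decreasing and
    bounded below by $g(t)$. *)
Lemma derivator_cvg_at_right (t : R) :
  g x @[x --> t^'+] --> (@rlim R R^o g t : R).
Proof.
have [mono bnd] : {in `]t, +oo[ &, nondecreasing_fun g} /\
    has_lbound (g @` `]t, +oo[).
  split; first by move=> x y _ _; exact: derivator_nondecreasing.
  exists (g t) => _ [x + <-]; rewrite /= in_itv/= andbT => tx.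
  exact/derivator_nondecreasing/ltW.
apply: (cvgP _ (@nondecreasing_at_right_cvgr R g t +oo%O _ mono bnd)).
by [].
Qed.

Lemma gjump_ge0 (t : R) : 0 <= gjump g t.
Proof.
rewrite /gjump /jump subr_ge0.
apply: (cvgr_to_ge (@derivator_cvg_at_right t)).
near=> x; apply: derivator_nondecreasing; apply: ltW; near: x.
exact: nbhs_right_gt.
Unshelve. all: end_near. Qed.

Lemma derivator_right_continuous (t : R) : ~ jump_set g t ->
  g x @[x --> t^'+] --> g t.
Proof.
move=> Dt; have -> : g t = rlim (V := R^o) g t :> R.
  apply/eqP; rewrite eq_sym -subr_eq0 eq_le gjump_ge0 andbT leNgt.
  exact/negP.
exact: derivator_cvg_at_right.
Qed.

(** Continuity of the measure from above along $[t,t+1/(n+1)[$, whose intersection is $\{t\}$; the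
    measures $g(t+1/(n+1))-g(t)$ tend to the jump of $g$. *)
Lemma derivator_measure_set1 (t : R) :
  derivator_measure g [set t] = (gjump g t)%:E.
Proof.
pose F (n : nat) : set (measurableTypeR R) := `[t, t + n.+1%:R^-1[%classic.
have FE n : derivator_measure g (F n) = (g (t + n.+1%:R^-1) - g t)%:E.
  by rewrite derivator_measure_itv// lerDl.
have capF : \bigcap_n F n = [set t].
  apply/seteqP; split=> [x Fx|x -> n _]; last first.
    by rewrite /F/= in_itv/= lexx ltrDl invr_gt0 ltr0n.
  have tx : t <= x by have := Fx 0%N Logic.I; rewrite /F/= in_itv/= => /andP[].
  apply/eqP; rewrite eq_le tx andbT leNgt; apply/negP => tltx.
  have xt : 0 < x - t by rewrite subr_gt0.
  have [N _ /(_ N (leqnn N))/=] := near_infty_natSinv_lt (PosNum xt).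
  have := Fx N Logic.I; rewrite /F/= in_itv/= => /andP[_].
  by rewrite -ltrBlDl ltNge => /negP xN /ltW.
have cF : (g (t + n.+1%:R^-1) - g t)%:E @[n --> \oo] -->
    derivator_measure g [set t].
  under eq_fun do rewrite -FE.
  rewrite -capF; apply: nonincreasing_cvg_mu.
  - suff : (derivator_measure g (F 0%N) < +oo)%E by [].
    by rewrite FE ltry.
  - by move=> i; exact: measurable_itv.
  - by rewrite capF; exact: measurable_set1.
  - move=> m n mn; apply/subsetPset => x; rewrite /F/= !in_itv/=.
    move=> /andP[-> /=].
    move=> /lt_le_trans; apply; rewrite lerD2l lef_pV2 ?posrE//.
    by rewrite ler_nat ltnS.
apply: (cvg_unique _ cF) => //.
apply: cvg_EFin; first by near=> n.
apply: cvgB; last exact: cvg_cst.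
move/cvg_at_rightP: (@derivator_cvg_at_right t); apply.
split; first by move=> n; rewrite ltrDl invr_gt0 ltr0n.
rewrite -[X in _ --> X]addr0; apply: cvgD; first exact: cvg_cst.
exact: cvg_harmonic.
Unshelve. all: end_near. Qed.

End atoms.

(** * The $L^1$ part of the norm as a sum of jumps *)

Section jump_integral.
Variables (R : realType) (V : normedModType R) (g : derivator R) (a b : R).
Variables (Lambda : set nat) (d : nat -> R).
(* [f \_ A] takes the value [point] off A, and a normed module need not have
   [0] as its distinguished point. *)
Hypothesis V_point : (point : V) = 0.
Hypothesis d_bij : set_bij Lambda (jump_set g `&` `[a, b[) d.

(** The integrand lives on countably many atoms, and at each of them the mass $\Delta g(d_k)$
    cancels the denominator of $h'_g(d_k)$. *)
Lemma integral_g_derivative (h : R -> V) :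
  (\int[derivator_measure g]_(t in `[a, b[)
    `|(g_derivative g h \_ (jump_set g)) t|%:E =
  \esum_(k in Lambda) `|jump h (d k)|%:E)%E.
Proof.
(* Indices outside [Lambda] get the empty set, so that the union runs over all of [nat]. *)
pose F (k : nat) : set (measurableTypeR R) :=
  if k \in Lambda then [set d k] else set0.
have DF : `[a, b[%classic `&` jump_set g = \bigcup_k F k.
  rewrite setIC; apply/seteqP; split=> [t|t [k _]].
    move=> Dt; case: d_bij => _ _ /(_ t Dt)[k Lk <-].
    by exists k => //; rewrite /F mem_set.
  rewrite /F; case: ifPn => // /set_mem Lk ->.
  by case: d_bij => dD _ _; exact: dD.
have mF k : measurable (F k).
  by rewrite /F; case: ifP => // _; exact: measurable_set1.
transitivity (\int[derivator_measure g]_(t in \bigcup_k F k)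
    `|g_derivative g h t|%:E)%E.
  rewrite -DF integral_mkcondr; apply: eq_integral => t _.
  by rewrite /patch; case: ifP => // _; rewrite V_point normr0.
rewrite ge0_integral_bigcup//; last 2 first.
(* Measurability of the integrand comes for free: every subset of the countable domain is countable,
   hence measurable. *)
- move=> mD Y mY; apply: countable_measurable.
    exact: measurable_set1.
  apply: (@sub_countable _ _ _ (d @` Lambda)).
    apply: subset_card_le => t [[k _] + _].
    rewrite /F; case: ifPn => // /set_mem Lk ->.
    by exists k.
  apply: sub_countable (card_image_le d Lambda) _; exact: countableP.
- move=> i j _ _; rewrite /F.
  case: ifPn => [/set_mem Li|_]; last by move=> [? []].
  case: ifPn => [/set_mem Lj|_]; last by move=> [? []].
  move=> [t [-> dij]]; case: d_bij => _ dinj _.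
  by apply: dinj => //; exact/mem_set.
have LE : Lambda = [set k | k \in Lambda].
  by apply/seteqP; split=> k /=; rewrite inE.
rewrite [in RHS]LE.
rewrite -nneseries_esum//.
rewrite [RHS]eseries_mkcond; apply: eq_eseriesr => k _.
rewrite /F; case: ifPn => kL; last by rewrite integral_set0.
rewrite (eq_integral (cst (`|g_derivative g h (d k)|%:E))); last first.
  by move=> x /set_mem ->.
rewrite integral_cst; last exact: measurable_set1.
set m := (X in (_ * X)%E).
have -> : m = (gjump g (d k))%:E by exact: derivator_measure_set1.
rewrite -EFinM /g_derivative; congr EFin.
have gk : 0 < gjump g (d k).
  by case: d_bij => dD _ _; have [] := dD k (set_mem kL).
by rewrite normrZ normfV gtr0_norm// mulrAC mulVf ?gt_eqF// mul1r.
Qed.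

End jump_integral.

(** * Partitions into finitely many classes of close elements *)

(** Total boundedness in terms of colors instead of centers: pairing two colorings refines both, so
    finitely many closeness requirements can be met together. Only the colors used on [A] are finite
    in number, so [T] may be [nat]. *)
Definition finitely_colorable (U : Type) (A : set U) (r : U -> U -> Prop) :=
  exists (T : Type) (col : U -> T), finite_set (col @` A) /\
    forall u v, A u -> A v -> col u = col v -> r u v.

Lemma finitely_colorable_image (U W : Type) (phi : U -> W) (A : set U)
    (r : W -> W -> Prop) :
  finitely_colorable (phi @` A) r ->
  finitely_colorable A (fun u v => r (phi u) (phi v)).
Proof.
move=> [T [col [fcol rcol]]]; exists T, (col \o phi); split.
  by rewrite image_comp in fcol.
by move=> u v Au Av; apply: rcol; [exists u|exists v].
Qed.

Lemma finitely_colorableI (U : Type) (A : set U) (r s : U -> U -> Prop) :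
  finitely_colorable A r -> finitely_colorable A s ->
  finitely_colorable A (fun u v => r u v /\ s u v).
Proof.
move=> [T [cr [fr rr]]] [T' [cs [fs ss]]].
exists (T * T')%type, (fun u => (cr u, cs u)); split.
  exact: (finite_image11 pair fr fs).
by move=> u v Au Av [cruv csuv]; split; [exact: rr|exact: ss].
Qed.

Lemma finitely_colorable_sub (U : Type) (A : set U) (r s : U -> U -> Prop) :
  (forall u v, A u -> A v -> r u v -> s u v) ->
  finitely_colorable A r -> finitely_colorable A s.
Proof.
move=> rs [T [col [fcol rcol]]]; exists T, col; split=> // u v Au Av cuv.
exact/rs/rcol.
Qed.

Lemma finitely_colorable_seq (U : Type) (I : eqType) (s : seq I) (A : set U)
    (r : I -> U -> U -> Prop) :
  (forall i, i \in s -> finitely_colorable A (r i)) ->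
  finitely_colorable A (fun u v => forall i, i \in s -> r i u v).
Proof.
elim: s => [_|i s IH h].
  by exists unit, (fun=> tt).
have hs : finitely_colorable A (fun u v => forall j, j \in s -> r j u v).
  by apply: IH => j js; apply: h; rewrite inE js orbT.
have := finitely_colorableI (h i (mem_head _ _)) hs.
apply: finitely_colorable_sub => u v _ _ [ri rs] j.
by rewrite inE => /predU1P[->//|/rs].
Qed.

(** * Bounded sets of real or complex scalars *)

Section scalars_colorable.
Variable R : realType.

(** The color of [x] is the index of its cell when $[-M,M]$ is cut, from $-M$ on, into half-open
    cells of length $e$. *)
Lemma real_colorable (A : set R) (M e : R) : (forall x, A x -> `|x| <= M) ->
  0 < e -> finitely_colorable A (fun x y => `|x - y| < e).
Proof.
move=> AM e0; pose col (x : R) := Num.truncn ((x + M) / e).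
have ge0 x : A x -> 0 <= (x + M) / e.
  move=> /AM; rewrite ler_norml => /andP[Mx _].
  by apply: divr_ge0; [rewrite -lerBlDr sub0r|exact: ltW].
exists nat, col; split.
  apply: (@sub_finite_set _ _ `I_(Num.truncn ((M + M) / e)).+1).
    move=> _ [x Ax <-]; rewrite /= ltnS; apply: le_truncn.
    rewrite ler_pM2r ?invr_gt0// lerD2r.
    by have := AM x Ax; rewrite ler_norml => /andP[].
  exact: finite_II.
move=> x y Ax Ay cxy.
have /andP[x1 x2] := truncn_itv (ge0 x Ax).
have /andP[y1 y2] := truncn_itv (ge0 y Ay).
rewrite -/(col _) in x1 x2 y1 y2; rewrite cxy in x1 x2.
have E u v : (u + M) / e < (col y).+1%:R -> (col y)%:R <= (v + M) / e ->
    u - v < e.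
  move=> ul vl.
  have : (u + M) / e < 1 + (v + M) / e.
    by apply: (lt_le_trans ul); rewrite -natr1 addrC lerD2l.
  rewrite -ltrBlDr -mulrBl ltr_pdivrMr// mul1r opprD addrACA subrr addr0.
  by [].
by rewrite ltr_norml E// ltrNl opprB E.
Qed.

Lemma scalars_colorable (F : scalar_field) (A : set (scalars R F)) (e : R) :
  bounded_set A -> 0 < e -> finitely_colorable A (fun x y => `|x - y| < e).
Proof.
move=> bA e0; have [M AM] : exists M, forall x, A x -> `|x| <= M.
  have /filter_ex[M AM] :
    \forall M \near +oo, forall x, A x -> `|x| <= M := bA.
  by exists M.
case: F {bA} A AM => /= A AM.
  exact: (@real_colorable _ M).
(* Complex case: real and imaginary parts are colored separately at precision $e/2$, since
   $|z|\le|\mathrm{Re}\,z|+|\mathrm{Im}\,z|$. *)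
have e20 : 0 < e / 2 by rewrite divr_gt0.
have normE (z : Rcomplex R) :
  `|z| = Num.sqrt (complex.Re z ^+ 2 + complex.Im z ^+ 2) by case: z.
have Re_le (z : Rcomplex R) : `|complex.Re z| <= `|z|.
  by rewrite normE -sqrtr_sqr ler_wsqrtr// lerDl sqr_ge0.
have Im_le (z : Rcomplex R) : `|complex.Im z| <= `|z|.
  by rewrite normE -sqrtr_sqr ler_wsqrtr// lerDr sqr_ge0.
have le_ReIm (z : Rcomplex R) : `|z| <= `|complex.Re z| + `|complex.Im z|.
  rewrite normE -[leRHS]ger0_norm ?addr_ge0// -sqrtr_sqr ler_wsqrtr//.
  rewrite sqrrD !real_normK ?num_real// -addrA lerD2l.
  by rewrite lerDr mulrn_wge0// mulr_ge0.
have cRe : finitely_colorable ((@complex.Re R) @` A)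
    (fun x y => `|x - y| < e / 2).
  by apply: (@real_colorable _ M) => // _ [z Az <-]; exact: le_trans (AM _ Az).
have cIm : finitely_colorable ((@complex.Im R) @` A)
    (fun x y => `|x - y| < e / 2).
  by apply: (@real_colorable _ M) => // _ [z Az <-]; exact: le_trans (AM _ Az).
have := finitely_colorableI (finitely_colorable_image cRe)
  (finitely_colorable_image cIm).
apply: finitely_colorable_sub => -[x1 x2] [y1 y2] /= _ _ [h1 h2].
by apply: (le_lt_trans (le_ReIm _)); rewrite [ltRHS]splitr ltrD.
Qed.

End scalars_colorable.

(** * Finite nets of points of $[a,b]$, uniform in $S$ *)

Section nets.
Variables (R : realType) (V : normedModType R) (g : derivator R) (a b : R).
Variable S : set (R -> V).

(** Nets for the closeness of points as seen by all of [S] at once. Net points may leave [A] but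
    stay in $[a,b]$, where the values of [S] will be bounded. *)
Definition has_net (A : set R) (e : R) := exists N : seq R,
  {subset N <= `[a, b]} /\ forall x, A x -> exists2 y, y \in N &
    forall f, S f -> `|f x - f y| < e.

Lemma has_net0 (e : R) : has_net set0 e.
Proof. by exists [::]; split. Qed.

Lemma has_netU (A B : set R) (e : R) :
  has_net A e -> has_net B e -> has_net (A `|` B) e.
Proof.
move=> [N [sN AN]] [N' [sN' BN']]; exists (N ++ N'); split.
  by move=> x; rewrite mem_cat => /orP[/sN|/sN'].
move=> x [/AN|/BN'] [y yN h]; exists y => //; rewrite mem_cat yN ?orbT//.
Qed.

Lemma has_net_sub (A B : set R) (e : R) :
  A `<=` B -> has_net B e -> has_net A e.
Proof. by move=> AB [N [sN BN]]; exists N; split=> // x /AB/BN. Qed.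

Lemma has_net1 (A : set R) (t e : R) : t \in `[a, b] ->
  (forall x, A x -> forall f, S f -> `|f x - f t| < e) -> has_net A e.
Proof.
move=> tab At; exists [:: t]; split; first by move=> x; rewrite inE => /eqP ->.
by move=> x /At h; exists t => //; rewrite inE.
Qed.

Hypothesis S_equi : g_equicontinuous g a b S.
Hypothesis S_stable : g_stable g a b S.

Lemma has_net_at_right (t e : R) : t \in `[a, b] -> 0 < e ->
  exists2 Q : set R, (\forall s \near t^'+, Q s) & has_net (Q `&` `[a, b]) e.
Proof.
move=> tab e0; have [bt|tb] := leP b t.
  exists [set s | t < s]; first exact: nbhs_right_gt.
  apply: has_net_sub (has_net0 e) => s [/= ts]; rewrite in_itv/= => /andP[_ sb].
  by have := lt_le_trans ts (le_trans sb bt); rewrite ltxx.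
have tab' : t \in `[a, b[ by rewrite in_itv/= tb andbT; case/andP: tab.
have [Dt|Dt] := pselect (jump_set g t).
  have [delta d0 [m [X [Xab Xcov Xosc]]]] := S_stable tab' Dt e0.
  exists `[t, t + delta[%classic.
    near=> s; rewrite /= in_itv/=; apply/andP; split.
      by apply: ltW; near: s; exact: nbhs_right_gt.
    by near: s; apply: nbhs_right_lt; rewrite ltrDl.
  (* One point from each piece of the covering given by stability; an empty piece contributes the
     default [t], which still lies in $[a,b]$. *)
  exists [seq xget t (X k) | k : 'I_m]; split.
    move=> _ /mapP[k _ ->]; case: xgetP => [y _ /Xab|_] //.
  move=> x /Xcov[k _ Xkx]; exists (xget t (X k)).
    by apply/mapP; exists k => //; rewrite mem_enum.
  by move=> f Sf; apply: (Xosc f Sf k) => //; exact: xgetI Xkx.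
(* Without a jump at [t], right continuity of [g] turns nearness to [t] into nearness of the values
   of [g], and equicontinuity makes [t] alone a net. *)
have [delta d0 Sdelta] := S_equi e0 tab.
exists [set s | `|g t - g s| < delta].
  by have /cvgrPdist_lt/(_ delta d0) := derivator_right_continuous Dt.
apply: has_net1 tab _ => s [/= gts sab] f Sf.
by rewrite distrC; exact: Sdelta.
Unshelve. all: end_near. Qed.

Lemma has_net_near (t e : R) : t \in `[a, b] -> 0 < e ->
  exists2 B : set R, nbhs t B & has_net (B `&` `[a, b]) e.
Proof.
move=> tab e0; have [Q] := has_net_at_right tab e0.
rewrite near_withinE => nQ netQ.
have [delta d0 Sdelta] := S_equi e0 tab.
have : \forall s \near t^'-, `|g t - g s| < delta.
  by have /cvgrPdist_lt/(_ delta d0) := @derivator_left_continuous _ g t.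
rewrite near_withinE => nP.
(* Both conditions are void at [s = t]; that point is covered by the net used on the left, as
   $|g(t)-g(t)|=0$. *)
exists [set s | (s < t -> `|g t - g s| < delta) /\ (t < s -> Q s)].
  exact: filterI.
have netP : has_net ([set s | `|g t - g s| < delta] `&` `[a, b]) e.
  apply: has_net1 tab _ => s [/= gts sab] f Sf.
  by rewrite distrC; exact: Sdelta.
apply: has_net_sub (has_netU netP netQ) => s [[/= Ps Qs] sab].
have [st|ts|->] := ltgtP s t; [by left; split; [exact: Ps|]|
  by right; split; [exact: Qs|]|].
by left; split; rewrite //= subrr normr0.
Qed.

(* Sets whose complement in [a, b] has a finite net form a filter; were it
   proper, it would have a cluster point in [a, b] by compactness. *)
Lemma has_net_segment (e : R) : 0 < e -> has_net `[a, b] e.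
Proof.
move=> e0; apply: contrapT => nonet.
pose F : set_system R := [set A | has_net (`[a, b] `\` A) e].
have FF : ProperFilter F.
  apply: Build_ProperFilter; first by rewrite /F/= setD0.
  split.
  - by rewrite /F/= setDT; exact: has_net0.
  - by move=> A B FA FB; rewrite /F/= setDIr; exact: has_netU.
  - by move=> A B AB; apply: has_net_sub => x [? nBx]; split=> // /AB.
have FI : F `[a, b]%classic by rewrite /F/= setDv; exact: has_net0.
have [t [tab clt]] := segment_compact FF FI.
have [B nB netB] := has_net_near tab e0.
have FB : F (~` (B `&` `[a, b]) `&` `[a, b]).
  apply: has_net_sub netB => x [xab /not_andP[/contrapT//|//]].
by have [x [[nBx xab] Bx]] := clt _ _ FB nB; apply: nBx.
Qed.

End nets.

(** * Estimates relating the DC norm, the supremum norm and the jumps *)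

Section DC_norm.
Variables (R : realType) (V : normedModType R) (g : derivator R) (a b : R).
Implicit Types f h c : R -> V.

Lemma jumpB f h (t : R) : cvg (f x @[x --> t^'+]) -> cvg (h x @[x --> t^'+]) ->
  jump (f \- h) t = jump f t - jump h t.
Proof.
move=> cf ch; rewrite /jump /rlim limB//= !opprB.
by rewrite [h t - f t]addrC addrACA [- _ + h t]addrC.
Qed.

(** The right-hand limit inherits the bound [M], because [t < b] keeps the points just after [t]
    inside $[a,b]$. *)
Lemma norm_jump_le h (t M : R) : t \in `[a, b[ -> cvg (h x @[x --> t^'+]) ->
  (forall x, x \in `[a, b] -> `|h x| <= M) -> `|jump h t| <= 2 * M.
Proof.
rewrite in_itv/= => /andP[a_t tb] ch hM.
rewrite mulr_natl mulr2n; apply: (le_trans (ler_normB _ _)); apply: lerD.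
  rewrite /rlim -lim_norm//; apply: limr_le; first exact: is_cvg_norm.
  near=> x; apply: hM; rewrite in_itv/=; apply/andP; split.
    by apply: (le_trans a_t); apply: ltW; near: x; exact: nbhs_right_gt.
  by apply: ltW; near: x; exact: nbhs_right_lt.
by apply: hM; rewrite in_itv/= a_t ltW.
Unshelve. all: end_near. Qed.

Lemma le_sup_norm f (t : R) : t \in `[a, b] -> (`|f t|%:E <= sup_norm a b f)%E.
Proof. by move=> tab; apply: ereal_sup_ubound; exists t. Qed.

Lemma sup_norm_le f (M : R) : (forall t, t \in `[a, b] -> `|f t| <= M) ->
  (sup_norm a b f <= M%:E)%E.
Proof.
by move=> fM; apply: ge_ereal_sup => _ [t tab <-]; rewrite lee_fin fM.
Qed.

Lemma norm_lt_DC_norm f (e t : R) : (DC_norm g a b f < e%:E)%E ->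
  t \in `[a, b] -> `|f t| < e.
Proof.
move=> fe tab; rewrite -lte_fin; apply: le_lt_trans fe.
rewrite -[leLHS]adde0; apply: leeD; first exact: le_sup_norm.
by apply: integral_ge0.
Qed.

Section enumerated.
Variables (Lambda : set nat) (d : nat -> R).
Hypothesis ab : a < b.
Hypothesis V_point : (point : V) = 0.
Hypothesis d_bij : set_bij Lambda (jump_set g `&` `[a, b[) d.

Lemma DC_normE f : DC_norm g a b f =
  (sup_norm a b f + \esum_(k in Lambda) `|jump f (d k)|%:E)%E.
Proof. by rewrite /DC_norm (integral_g_derivative V_point d_bij). Qed.

Lemma esum_jump_lt f (e : R) : (DC_norm g a b f < e%:E)%E ->
  (\esum_(k in Lambda) `|jump f (d k)|%:E < e%:E)%E.
Proof.
rewrite DC_normE; apply: le_lt_trans; rewrite -[leLHS]add0e; apply: leeD => //.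
apply: (@le_trans _ _ `|f a|%:E) => //; apply: le_sup_norm.
by rewrite in_itv/= lexx ltW.
Qed.

Lemma DC_cvg f k : DC g a b f -> Lambda k -> cvg (f x @[x --> (d k)^'+]).
Proof. by case: d_bij => dD _ _ [_ + _] /dD; apply. Qed.

Lemma DC_jumpB f h k : DC g a b f -> DC g a b h -> Lambda k ->
  jump (f \- h) (d k) = jump f (d k) - jump h (d k).
Proof. by move=> Df Dh Lk; rewrite jumpB//; exact: DC_cvg. Qed.

Lemma esum_jump_lty f : DC g a b f ->
  (\esum_(k in Lambda) `|jump f (d k)|%:E < +oo)%E.
Proof. by case=> _ _; rewrite (reindex_esum _ _ _ _ d_bij). Qed.

(** Tails of a convergent series vanish. The bound is stated for all [m] past [n] so that finitely
    many functions can share one index. *)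
Lemma esum_jump_tail f (e : R) : DC g a b f -> 0 < e -> exists n : nat,
  forall m, (n <= m)%N ->
  (\esum_(k in Lambda `&` [set k | (m < k)%N]) `|jump f (d k)|%:E < e%:E)%E.
Proof.
move=> /esum_jump_lty fy e0.
set u := fun k => `|jump f (d k)|%:E in fy *.
have u0 k : (0 <= u k)%E by rewrite lee_fin.
have LE : Lambda = [set k | k \in Lambda].
  by apply/seteqP; split=> k /=; rewrite inE.
rewrite LE -nneseries_esum// in fy.
have := nneseries_tail_cvg fy (fun k _ => u0 k).
move=> /(_ [set x | (x < e%:E)%E])[|n _ nP].
  by apply: open_ereal_lt'; rewrite lte_fin.
(* The strict condition [m < k] makes this the series tail starting at [m.+1]. *)
exists n => m nm; apply: le_lt_trans (nP m.+1 (leqW nm)).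
rewrite eseries_cond nneseries_esum//.
suff -> : Lambda `&` [set k | (m < k)%N] =
  [set k | (k \in Lambda) && (m.+1 <= k)%N] by [].
by rewrite {1}LE; apply/seteqP; split=> k /= => [[-> ->]|/andP[]].
Qed.

Lemma esum_jump_le f (n : nat) (M : R) :
  (forall k, Lambda k -> `|jump f (d k)| <= M) -> 0 <= M ->
  (\esum_(k in Lambda) `|jump f (d k)|%:E <= (n.+1%:R * M)%:E +
    \esum_(k in Lambda `&` [set k | (n < k)%N]) `|jump f (d k)|%:E)%E.
Proof.
move=> fM M0; rewrite (esumID [set k | (n < k)%N])// addeC; apply: leeD => //.
rewrite esum_mkcondl.
(* The remaining indices are $0,\dots,n$, whence the factor [n.+1]; those outside [Lambda]
   contribute zero. *)
have -> : ~` [set k | (n < k)%N] = `I_n.+1.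
  by apply/seteqP; split=> k /=; rewrite ltnS [(k <= n)%N]leqNgt => /negP.
apply: (@le_trans _ _ (\esum_(k in `I_n.+1) M%:E)%E).
  by apply: le_esum => k _; case: ifPn => [/set_mem/fM|_]; rewrite lee_fin.
rewrite esum_fset//.
by rewrite -fsbig_ord sumEFin sumr_const card_ord mulr_natl.
Qed.

End enumerated.
End DC_norm.

(** * Choices common to finitely many centers *)

Lemma finite_set_ub_nat (T : Type) (C : set T) (P : T -> nat -> Prop) :
  finite_set C -> (forall c, C c -> exists n, forall m, (n <= m)%N -> P c m) ->
  exists n, forall c, C c -> P c n.
Proof.
move=> finC CP.
have /choice[N NP] : forall c, exists n, C c -> forall m, (n <= m)%N -> P c m.
  by move=> c; have [/CP[n nP]|nC] := pselect (C c); [exists n|exists 0%N].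
have [M MN] : exists M, forall c, C c -> (N c <= M)%N.
  have /finite_seqP[s sE] := finite_image N finC.
  exists (\max_(i <- s) i)%N => c Cc; apply: (@leq_bigmax_seq _ _ _ id) => //.
  by have : (N @` C) (N c) by [exists c]; rewrite sE.
by exists M => c Cc; apply: NP => //; exact: MN.
Qed.

(** A property of all small radii holds at $1/(n+1)$ for all large $n$, which reduces the claim to a
    common index. *)
Lemma finite_set_lb_pos (R : realType) (T : Type) (C : set T)
    (P : T -> R -> Prop) :
  finite_set C ->
  (forall c, C c -> exists2 r, 0 < r & forall s, 0 < s -> s <= r -> P c s) ->
  exists2 r, 0 < r & forall c, C c -> P c r.
Proof.
move=> finC CP.
have [n nP] : exists n, forall c, C c -> P c n.+1%:R^-1.
  apply: finite_set_ub_nat finC _ => c /CP[r r0 rP].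
  have [n _ nr] := near_infty_natSinv_lt (PosNum r0).
  by exists n => m nm; apply: rP; rewrite ?invr_gt0//; exact/ltW/nr.
by exists n.+1%:R^-1.
Qed.

(** * From total boundedness to the four conditions *)

Section necessity.
Variables (R : realType) (V : normedModType R) (g : derivator R) (a b : R).
Variables (Lambda : set nat) (d : nat -> R) (S : set (R -> V)).
Hypothesis ab : a < b.
Hypothesis V_point : (point : V) = 0.
Hypothesis d_bij : set_bij Lambda (jump_set g `&` `[a, b[) d.
Hypothesis S_DC : S `<=` DC g a b.
Hypothesis S_tb : DC_totally_bounded g a b S.

Lemma DC_totally_bounded_bounded (t : R) : t \in `[a, b] ->
  bounded_set [set f t | f in S].
Proof.
move=> tab; have [C [finC CD] CS] := S_tb ltr01.
have [n nP] : exists n : nat, forall c, C c -> `|c t| <= n%:R.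
  apply: finite_set_ub_nat finC _ => c Cc; exists (Num.truncn `|c t|).+1.
  move=> m nm; apply: ltW; apply: lt_le_trans (truncnS_gt _) _.
  by rewrite ler_nat.
(* The added [1] is the radius of the balls chosen above. *)
exists (n%:R + 1); split=> // M nM _ [f Sf <-].
have [c Cc /norm_lt_DC_norm/(_ tab)/= fc] := CS f Sf.
apply: ltW; apply: le_lt_trans nM; rewrite -(subrK (c t) (f t)) addrC.
by apply: (le_trans (ler_normD _ _)); apply: lerD; [exact: nP|exact: ltW].
Qed.

(** Triangle inequality through [c x] and [c y], one third of [e] for each leg. *)
Lemma dist_via_center (f c : R -> V) (x y e : R) :
  (DC_norm g a b (f \- c)%R < (e / 3)%:E)%E -> x \in `[a, b] -> y \in `[a, b] ->
  `|c x - c y| < e / 3 -> `|f x - f y| < e.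
Proof.
move=> fc xab yab cxy.
have hx := norm_lt_DC_norm fc xab; have hy := norm_lt_DC_norm fc yab.
have -> : f x - f y = (f x - c x) - (f y - c y) + (c x - c y).
  by rewrite opprB addrAC !subrKA.
rewrite /= in hx hy.
have := ler_normD (f x - c x - (f y - c y)) (c x - c y).
have := ler_normB (f x - c x) (f y - c y).
lra.
Qed.

Lemma DC_totally_bounded_equicontinuous : g_equicontinuous g a b S.
Proof.
move=> e e0 t tab; have e30 : 0 < e / 3 by rewrite divr_gt0.
have [C [finC CD] CS] := S_tb e30.
have [delta d0 deltaP] : exists2 delta, 0 < delta & forall c, C c ->
    forall s, s \in `[a, b] -> `|g t - g s| < delta -> `|c t - c s| < e / 3.
  apply: finite_set_lb_pos finC _ => c /CD[[_ cg] _ _].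
  have [r r0 rP] := cg t tab _ e30.
  by exists r => // s _ sr x xab gx; apply: rP => //; exact: lt_le_trans sr.
exists delta => // f /CS[c Cc fc] s sab gs.
by apply: (dist_via_center fc) => //; exact: deltaP.
Qed.

(** Two pieces suffice: $\{t\}$ and the part of $]t,t+\delta[$ in $[a,b]$, where each center is
    within $e/6$ of its right-hand limit and so varies by less than $e/3$. *)
Lemma DC_totally_bounded_stable : g_stable g a b S.
Proof.
move=> t tab Dt e e0; have e30 : 0 < e / 3 by rewrite divr_gt0.
have e60 : 0 < e / 6 by rewrite divr_gt0.
have [C [finC CD] CS] := S_tb e30.
have [delta d0 deltaP] : exists2 delta, 0 < delta & forall c, C c ->
    forall s, t < s -> s < t + delta -> `|rlim c t - c s| < e / 6.
  apply: finite_set_lb_pos finC _ => c /CD[_ cc _].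
  have /cvgrPdist_lt/(_ _ e60) := cc t (conj Dt tab).
  move=> [r r0 rP]; exists r => // s _ sr x tx xs; apply: rP => //=.
  by rewrite distrC gtr0_norm ?subr_gt0// ltrBlDl (lt_le_trans xs)// lerD2l.
have tab' : t \in `[a, b].
  by move: tab; rewrite !in_itv/= => /andP[-> /ltW].
exists delta => //; exists 2, (fun k : 'I_2 => if k == ord0 then [set t] else
  `]t, t + delta[ `&` `[a, b]); split.
- by move=> k; case: ifP => _ x; [move=> ->|case].
- move=> x [/=]; rewrite in_itv/= => /andP[+ xt] xab.
  rewrite le_eqVlt => /predU1P[<-|tx]; first by exists ord0.
  by exists ord_max => //; split; rewrite //= in_itv/= tx.
- move=> f /CS[c Cc fc] k x y; case: ifP => _.
    by move=> -> ->; rewrite subrr normr0.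
  move=> [/=]; rewrite in_itv/= => /andP[tx xt] xab.
  move=> [/=]; rewrite in_itv/= => /andP[ty yt] yab.
  apply: (dist_via_center fc) => //.
  have := deltaP c Cc x tx xt; have := deltaP c Cc y ty yt.
  have -> : c x - c y = (rlim c t - c y) - (rlim c t - c x).
    by rewrite opprB [RHS]addrC subrKA.
  have := ler_normB (rlim c t - c y) (rlim c t - c x).
  lra.
Qed.

Lemma DC_totally_bounded_tail (e : R) : 0 < e -> exists n : nat,
  forall f, S f ->
  (\esum_(k in Lambda `&` [set k | (n < k)%N]) `|jump f (d k)|%:E < e%:E)%E.
Proof.
move=> e0; have e20 : 0 < e / 2 by rewrite divr_gt0.
have [C [finC CD] CS] := S_tb e20.
have [n nP] := finite_set_ub_nat finC
  (fun c Cc => esum_jump_tail d_bij (CD c Cc) e20).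
exists n => f Sf; have [c Cc fc] := CS f Sf.
rewrite [ltRHS](_ : _ = (e / 2)%:E + (e / 2)%:E)%E; last first.
  by rewrite -EFinD -splitr.
(* Half of [e] bounds all jumps of [f - c] through the DC norm, the other half the tail of the
   center. *)
apply: le_lt_trans (lteD (esum_jump_lt ab V_point d_bij fc) (nP c Cc)).
apply: (@le_trans _ _ (\esum_(k in Lambda `&` [set k | (n < k)%N])
  (`|jump (f \- c)%R (d k)|%:E + `|jump c (d k)|%:E))%E).
  apply: le_esum => k [Lk _]; rewrite -EFinD lee_fin.
  rewrite (DC_jumpB d_bij (S_DC Sf) (CD c Cc) Lk).
  by rewrite -{1}(subrK (jump c (d k)) (jump f (d k))) ler_normD.
rewrite esumD//; apply: leeD => //.
rewrite esum_mkcondr; apply: le_esum => k _.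
by case: ifP => // _; rewrite lee_fin.
Qed.

End necessity.

(** * From the four conditions to total boundedness *)

Section sufficiency.
Variables (R : realType) (V : normedModType R) (g : derivator R) (a b : R).
Variables (Lambda : set nat) (d : nat -> R) (S : set (R -> V)).
Hypothesis V_point : (point : V) = 0.
Hypothesis V_colorable : forall (A : set V) (e : R), bounded_set A -> 0 < e ->
  finitely_colorable A (fun x y => `|x - y| < e).
Hypothesis d_bij : set_bij Lambda (jump_set g `&` `[a, b[) d.
Hypothesis S_DC : S `<=` DC g a b.

Lemma colorable_totally_bounded :
  (forall e : R, 0 < e ->
    finitely_colorable S (fun f h => (DC_norm g a b (f \- h)%R < e%:E)%E)) ->
  DC_totally_bounded g a b S.
Proof.
move=> col e /col[T [c [finc cP]]].
(* The centers are representatives in [S] of the colors that occur, hence lie in [DC]; for such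
   colors the default [0] is not reached. *)
pose rep z := xget (0 : R -> V) (S `&` [set f | c f = z]).
have repP f : S f -> S (rep (c f)) /\ c (rep (c f)) = c f.
  by move=> Sf; apply: (@xgetI _ _ (S `&` _) f).
exists (rep @` (c @` S)).
  split; first exact: finite_image.
  by move=> _ [_ [f Sf <-] <-]; apply: S_DC; have [] := repP f Sf.
move=> f Sf; exists (rep (c f)); first by exists (c f) => //; exists f.
by have [Sr cr] := repP f Sf; apply: cP.
Qed.

Hypothesis S_bounded :
  forall t, t \in `[a, b] -> bounded_set [set f t | f in S].
Hypothesis S_equi : g_equicontinuous g a b S.
Hypothesis S_stable : g_stable g a b S.
Hypothesis S_tail : forall e : R, 0 < e -> exists n : nat, forall f, S f ->
  (\esum_(k in Lambda `&` [set k | (n < k)%N]) `|jump f (d k)|%:E < e%:E)%E.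

Lemma uniform_colorable (e : R) : 0 < e ->
  finitely_colorable S
    (fun f h => forall x, x \in `[a, b] -> `|f x - h x| < e).
Proof.
move=> e0; have e30 : 0 < e / 3 by rewrite divr_gt0.
have [N [Nab NP]] := has_net_segment S_equi S_stable e30.
have : finitely_colorable S (fun f h => forall y, y \in N ->
    `|f y - h y| < e / 3).
  apply: (@finitely_colorable_seq _ _ _ _ (fun y f h => `|f y - h y| < e / 3)).
  move=> y /Nab/S_bounded Sy.
  exact: (finitely_colorable_image (V_colorable Sy e30)).
apply: finitely_colorable_sub => f h Sf Sh fh x xab.
have [y yN yP] := NP x xab.
have hf := yP f Sf; have hh := yP h Sh; have := fh y yN.
have -> : f x - h x = (f x - f y) - (h x - h y) + (f y - h y).
  by rewrite opprB addrAC !subrKA.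
have := ler_normD (f x - f y - (h x - h y)) (f y - h y).
have := ler_normB (f x - f y) (h x - h y).
lra.
Qed.

Lemma DC_totally_bounded_of : DC_totally_bounded g a b S.
Proof.
apply: colorable_totally_bounded => e e0.
have e40 : 0 < e / 4 by rewrite divr_gt0.
have [n nP] := S_tail e40.
(* If $|f-h|\le\eta$ on $[a,b]$, the supremum norm costs $\eta$ and each of the first $n+1$ jumps at
   most $2\eta$, in all $q\eta$. Taking $\eta=e/(4q)$ makes this $e/4$; the tails of [f] and [h] add
   less than $e/4$ each. *)
pose q : R := 2 * n.+1%:R + 1.
have q0 : 0 < q by rewrite addr_gt0// mulr_gt0.
have [eta_gt0 qeta] : 0 < e / 4 / q /\ q * (e / 4 / q) = e / 4.
  by split; [rewrite divr_gt0|rewrite mulrC divfK// gt_eqF].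
move: (e / 4 / q) eta_gt0 qeta => eta eta0 qeta.
have [T [c [finc cP]]] := uniform_colorable eta0.
exists T, c; split=> // f h Sf Sh /(cP _ _ Sf Sh) fh.
have Df := S_DC Sf; have Dh := S_DC Sh.
have fh_le x : x \in `[a, b] -> `|(f \- h) x| <= eta by move=> /fh/ltW.
rewrite (DC_normE V_point d_bij).
have jump_le k : Lambda k -> `|jump (f \- h)%R (d k)| <= 2 * eta.
  move=> Lk; apply: norm_jump_le fh_le.
    by case: d_bij => dD _ _; have [] := dD k Lk.
  by apply: is_cvgB; exact: (DC_cvg d_bij).
have eta20 : 0 <= 2 * eta by rewrite mulr_ge0// ltW.
have sum_le := esum_jump_le n jump_le eta20.
apply: le_lt_trans (leeD (sup_norm_le fh_le) sum_le) _.
apply: (@le_lt_trans _ _ (eta%:E + ((n.+1%:R * (2 * eta))%:E + (\esum_(k in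
  Lambda `&` [set k | (n < k)%N]) `|jump f (d k)|%:E +
  \esum_(k in Lambda `&` [set k | (n < k)%N]) `|jump h (d k)|%:E)))%E).
  apply: leeD => //; apply: leeD => //; rewrite -esumD//.
  apply: le_esum => k [Lk _]; rewrite -EFinD lee_fin (DC_jumpB d_bij Df Dh Lk).
  exact: ler_normB.
rewrite addeA -EFinD.
have -> : eta + n.+1%:R * (2 * eta) = e / 4 by rewrite -qeta /q; ring.
apply: (@lt_trans _ _ ((e / 4)%:E + ((e / 4)%:E + (e / 4)%:E))%E).
  by apply: lee_ltD => //; apply: lteD; exact: nP.
by rewrite -!EFinD lte_fin; lra.
Qed.

End sufficiency.

Theorem theorem6p7 (R : realType) (F : scalar_field) (a b : R)
    (g : derivator R) (Lambda : set nat) (d : nat -> R)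
    (S : set (R -> scalars R F)) :
  a < b ->
  set_bij Lambda (jump_set g `&` `[a, b[) d ->
  S `<=` DC g a b ->
  (DC_totally_bounded g a b S <->
  [/\ forall t, t \in `[a, b] -> bounded_set [set f t | f in S],
      g_equicontinuous g a b S,
      g_stable g a b S &
      forall e : R, 0 < e -> exists n : nat, forall f, S f ->
        (\esum_(k in Lambda `&` [set k | (n < k)%N]) `|jump f (d k)|%:E
           < e%:E)%E]).
Proof.
move=> ab d_bij S_DC.
have V_point : (point : scalars R F) = 0 by case: F S S_DC.
split=> [S_tb|[S_bounded S_equi S_stable S_tail]].
  split.
  - exact: (DC_totally_bounded_bounded S_tb).
  - exact: DC_totally_bounded_equicontinuous S_tb.
  - exact: DC_totally_bounded_stable S_tb.
  - exact: (DC_totally_bounded_tail ab V_point d_bij S_DC S_tb).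
apply: (DC_totally_bounded_of V_point _ d_bij) => // A e.
exact: scalars_colorable.
Qed.
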